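(* Let $C\leq KG$ be an additive left group code. Then the following hold: (1) $C$ is TE-LCD if and only if there exists an $FG$-linear projector $P\in\operatorname{End}_{FG}(KG)$ such that $\operatorname{Im}(P)=C$ and $P$ is self-adjoint with respect to $\langle\cdot,\cdot\rangle_{\mathrm{TE}}$. (2) If $m$ is even, then $C$ is TH-LCD if and only if there exists an $FG$-linear projector $P\in\operatorname{End}_{FG}(KG)$ such that $\operatorname{Im}(P)=C$ and $P$ is self-adjoint with respect to $\langle\cdot,\cdot\rangle_{\mathrm{TH}}$.
   Context: $F=\mathbb{F}_q$ is a finite field, $K=\mathbb{F}_{q^m}$ is its extension of degree $m$, $G$ is a finite group, and $FG\subseteq KG$ are the group algebras; $KG$ is viewed as a left $FG$-module. An additive left group code is a left $FG$-submodule $C\leq KG$ (not necessarily a $K$-subspace). For $x=\sum_{g\in G}a_g g$ and $y=\sum_{g\in G}b_g g$ in $KG$, the trace-Euclidean form is $\langle x,y\rangle_{\mathrm{TE}}=\operatorname{Tr}_{K/F}\left(\sum_{g\in G}a_gb_g\right)$ and, when $m$ is even, the trace-Hermitian form is $\langle x,y\rangle_{\mathrm{TH}}=\operatorname{Tr}_{K/F}\left(\sum_{g\in G}a_g\overline{b_g}\right)$, where $\overline{b}=b^{q^{m/2}}$ for $b\in K$. Both are non-degenerate symmetric $F$-bilinear forms on $KG$. For $\star\in\{\mathrm{TE},\mathrm{TH}\}$, $C^{\perp_\star}=\{x\in KG:\langle x,c\rangle_\star=0\text{ for all }c\in C\}$, and $C$ is called $\star$-LCD if $C\cap C^{\perp_\star}=\{0\}$.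 An $FG$-linear projector is an element $P\in\operatorname{End}_{FG}(KG)$ with $P^2=P$. The adjoint of $T\in\operatorname{End}_{FG}(KG)$ with respect to $\langle\cdot,\cdot\rangle_\star$ is the unique $F$-linear map $T^{*}$ with $\langle Tx,y\rangle_\star=\langle x,T^{*}y\rangle_\star$ for all $x,y\in KG$; $T$ is self-adjoint if $T^*=T$. *)

(* Defs.v *)
From HB Require Import structures.
Set Warnings "-notation-overridden,-ambiguous-paths,-redundant-canonical-projection".
From mathcomp Require Import all_boot all_order all_algebra all_fingroup all_solvable all_field.
Set Implicit Arguments. Unset Strict Implicit. Unset Printing Implicit Defensive.
Import GRing.Theory.
Local Open Scope ring_scope.

(* The sum of the a_g g is encoded by the function g |-> a_g.  The alias keeps
   the convolution product apart from the pointwise product on {ffun gT -> R}. *)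
Definition grpalg (R : Type) (gT : finGroupType) : predArgType :=
  {ffun gT -> R}.

HB.instance Definition _ (R : nzRingType) (gT : finGroupType) :=
  GRing.Zmodule.copy (grpalg R gT) {ffun gT -> R}.

Section GroupAlgebra.
Variables (R : nzRingType) (gT : finGroupType).
Implicit Types x y z : grpalg R gT.

Definition grpalg_one : grpalg R gT := [ffun g => (g == 1%g)%:R].
Definition grpalg_mul x y : grpalg R gT :=
  [ffun g => \sum_(h : gT) x h * y (h^-1 * g)%g].

Fact grpalg_mulA : associative grpalg_mul.
Proof.
move=> x y z; apply/ffunP=> g; rewrite !ffunE.
under eq_bigr => h _ do rewrite ffunE mulr_sumr.
under [RHS]eq_bigr => h _ do rewrite ffunE mulr_suml.
rewrite [RHS]exchange_big; apply: eq_bigr => h _.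
rewrite [RHS](reindex_inj (mulgI h)); apply: eq_bigr => k _ /=.
by rewrite mulKg invMg mulgA mulrA.
Qed.

Fact grpalg_mul1 : left_id grpalg_one grpalg_mul.
Proof.
move=> x; apply/ffunP=> g; rewrite ffunE (bigD1 1%g) //= ffunE eqxx mul1r.
by rewrite invg1 mul1g big1 ?addr0 // => h /negPf h1; rewrite ffunE h1 mul0r.
Qed.

Fact grpalg_mulr1 : right_id grpalg_one grpalg_mul.
Proof.
move=> x; apply/ffunP=> g; rewrite ffunE (bigD1 g) //= ffunE mulVg eqxx mulr1.
rewrite big1 ?addr0 // => h hg; rewrite ffunE -eq_mulVg1.
by rewrite (negPf hg) mulr0.
Qed.

Fact grpalg_mulDl : left_distributive grpalg_mul +%R.
Proof.
move=> x y z; apply/ffunP=> g; rewrite !ffunE -big_split.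
by apply: eq_bigr => h _; rewrite ffunE mulrDl.
Qed.

Fact grpalg_mulDr : right_distributive grpalg_mul +%R.
Proof.
move=> x y z; apply/ffunP=> g; rewrite !ffunE -big_split.
by apply: eq_bigr => h _; rewrite ffunE mulrDr.
Qed.

Fact grpalg_one_neq0 : grpalg_one != 0.
Proof.
by apply/eqP=> /ffunP/(_ 1%g)/eqP; rewrite !ffunE eqxx oner_eq0.
Qed.

HB.instance Definition _ := GRing.Zmodule_isNzRing.Build (grpalg R gT)
  grpalg_mulA grpalg_mul1 grpalg_mulr1 grpalg_mulDl grpalg_mulDr
  grpalg_one_neq0.

Definition grpalg_scale (a : R) x : grpalg R gT := [ffun g => a * x g].

Fact grpalg_scaleA a b x :
  grpalg_scale a (grpalg_scale b x) = grpalg_scale (a * b) x.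
Proof. by apply/ffunP=> g; rewrite !ffunE mulrA. Qed.

Fact grpalg_scale1 : left_id 1 grpalg_scale.
Proof. by move=> x; apply/ffunP=> g; rewrite !ffunE mul1r. Qed.

Fact grpalg_scaleDr : right_distributive grpalg_scale +%R.
Proof. by move=> a x y; apply/ffunP=> g; rewrite !ffunE mulrDr. Qed.

Fact grpalg_scaleDl x : {morph grpalg_scale^~ x : a b / a + b}.
Proof. by move=> a b; apply/ffunP=> g; rewrite !ffunE mulrDl. Qed.

HB.instance Definition _ := GRing.Zmodule_isLmodule.Build R (grpalg R gT)
  grpalg_scaleA grpalg_scale1 grpalg_scaleDr grpalg_scaleDl.

Fact grpalg_scaleAl (a : R) x y : a *: (x * y) = (a *: x) * y.
Proof.
apply/ffunP=> g; rewrite !ffunE mulr_sumr.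
by apply: eq_bigr => h _; rewrite ffunE mulrA.
Qed.

HB.instance Definition _ :=
  GRing.Lmodule_isLalgebra.Build R (grpalg R gT) grpalg_scaleAl.

End GroupAlgebra.

Section Inclusion.
Variables (F : finFieldType) (K : fieldExtType F) (gT : finGroupType).
Local Notation FG := (grpalg F gT).

Definition grpalg_incl (a : FG) : grpalg K gT := [ffun g => (a g)%:A].

Fact grpalg_incl1 : grpalg_incl 1 = 1.
Proof. by apply/ffunP=> g; rewrite !ffunE scaler_nat. Qed.

Fact grpalg_inclD a b : grpalg_incl (a + b) = grpalg_incl a + grpalg_incl b.
Proof. by apply/ffunP=> g; rewrite !ffunE scalerDl. Qed.

Fact grpalg_inclM a b : grpalg_incl (a * b) = grpalg_incl a * grpalg_incl b.
Proof.
apply/ffunP=> g; rewrite !ffunE scaler_suml; apply: eq_bigr => h _.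
by rewrite !ffunE -scalerAl mul1r scalerA.
Qed.

End Inclusion.

(* KG with scalars restricted from KG to FG. *)
Definition grpmod (F : finFieldType) (K : fieldExtType F) (gT : finGroupType)
  : predArgType := grpalg K gT.

HB.instance Definition _ (F : finFieldType) (K : fieldExtType F) gT :=
  GRing.Zmodule.copy (grpmod K gT) (grpalg K gT).

Section RestrictedModule.
Variables (F : finFieldType) (K : fieldExtType F) (gT : finGroupType).
Local Notation FG := (grpalg F gT).
Local Notation KG := (grpmod K gT).

Definition grpmod_scale (a : FG) (x : KG) : KG :=
  grpalg_incl K a * (x : grpalg K gT).

Fact grpmod_scaleA a b x :
  grpmod_scale a (grpmod_scale b x) = grpmod_scale (a * b) x.
Proof. by rewrite /grpmod_scale grpalg_inclM mulrA. Qed.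

Fact grpmod_scale1 : left_id 1 grpmod_scale.
Proof. by move=> x; rewrite /grpmod_scale grpalg_incl1 mul1r. Qed.

Fact grpmod_scaleDr : right_distributive grpmod_scale +%R.
Proof. by move=> a x y; apply: mulrDr. Qed.

Fact grpmod_scaleDl x : {morph grpmod_scale^~ x : a b / a + b}.
Proof. by move=> a b; rewrite /grpmod_scale grpalg_inclD mulrDl. Qed.

HB.instance Definition _ := GRing.Zmodule_isLmodule.Build FG KG
  grpmod_scaleA grpmod_scale1 grpmod_scaleDr grpmod_scaleDl.

End RestrictedModule.

Section Forms.
Variables (F : finFieldType) (K : fieldExtType F) (gT : finGroupType).
Local Notation FG := (grpalg F gT).
Local Notation KG := (grpmod K gT).

(* finvect_type K is K with its structure of (Galois) splitting field over the
   finite field F.  The trace is K-valued, with values in the copy 1%VS of F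
   inside K (fftr_in_F), and is the usual sum of q-powers (fftrE). *)
Definition fftr (a : K) : K :=
  @galTrace F (finvect_type K) 1 {:finvect_type K} a.

Definition te_form (x y : KG) : K := fftr (\sum_(g : gT) x g * y g).

Definition ffconj (b : K) : K := b ^+ (#|F| ^ (\dim {:K})./2).

(* Only meaningful when \dim {:K} is even. *)
Definition th_form (x y : KG) : K := fftr (\sum_(g : gT) x g * ffconj (y g)).

Section WithForm.
Variable B : KG -> KG -> K.

Definition perp (C : {pred KG}) (x : KG) : Prop :=
  forall c, c \in C -> B x c = 0.

Definition lcd (C : {pred KG}) : Prop :=
  forall x, x \in C /\ perp C x <-> x = 0.

(* (a%:A : FG) is the image a 1_G of the scalar a of F. *)
Definition F_linear (S : KG -> KG) : Prop :=
  forall (a : F) x y, S ((a%:A : FG) *: x + y) = (a%:A : FG) *: S x + S y.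

Definition is_adjoint (T S : KG -> KG) : Prop :=
  F_linear S /\ forall x y, B (T x) y = B x (S y).

(* The adjoint is unique by te_adjoint_uniq and th_adjoint_uniq, so this says
   that the adjoint of T is T itself. *)
Definition self_adjoint (T : KG -> KG) : Prop := is_adjoint T T.

End WithForm.

Fact fftr_in_F a : fftr a \in 1%VS.
Proof.
apply: (@mem_galTrace _ (finvect_type K)); last exact: memvf.
exact/finField_galois/sub1v.
Qed.

Fact fftrE a : fftr a = \sum_(i < \dim {:K}) a ^+ (#|F| ^ i).
Proof.
pose L : splittingFieldType F := finvect_type K.
have s1L : (1 <= {:L})%VS := sub1v _.
have [s /eqP gen_s sE] := finField_galois_generator s1L.
have os : #[s]%g = \dim {:L}.
  by rewrite orderE -gen_s -(galois_dim (finField_galois s1L)) dimv1 divn1.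
have sXE i (b : L) : (s ^+ i)%g b = b ^+ (#|F| ^ i).
  elim: i b => [|i IHi] b; first by rewrite expg0 gal_id expn0 expr1.
  rewrite expgSr galM ?memvf // IHi sE ?memvf //.
  by rewrite dimv1 expn1 -exprM expnSr.
have inj_s : injective (fun i : 'I_(\dim {:L}) => (s ^+ i)%g).
  move=> i j /eqP; rewrite eq_expg_mod_order os !modn_small // => /eqP.
  exact: val_inj.
rewrite /fftr /galTrace -/L gen_s.
have -> : \dim {:K} = \dim {:L} by [].
transitivity (\sum_(x in [set (s ^+ i)%g | i : 'I_(\dim {:L})]) x a).
  apply: eq_bigl => x; apply/idP/imsetP => [/cyclePmin[i]|[i _ ->]].
    by rewrite os => lt_i ->; exists (Ordinal lt_i).
  exact: mem_cycle.
rewrite big_imset /=; last by move=> i j _ _; apply: inj_s.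
by apply: eq_bigr => i _; apply: sXE.
Qed.

Fact fftr_neq0 : exists a, fftr a != 0.
Proof.
pose L : splittingFieldType F := finvect_type K.
have [a _ ta] := @gal_independent_contra F L {:L}%AS
  [in 'Gal({:L} / 1)%g] (fun=> 1) 1%g (group1 _) (oner_neq0 _).
by exists a; move: ta; under eq_bigr => s _ do rewrite mul1r.
Qed.

Fact fftrB : {morph fftr : a b / a - b}.
Proof. exact: raddfB (galTrace 1 {:finvect_type K}). Qed.

Fact fftr_nondeg a : (forall b, fftr (b * a) = 0) -> a = 0.
Proof.
move=> tr0; apply/eqP/idPn => a0; have [c /eqP[]] := fftr_neq0.
by rewrite -(divfK a0 c).
Qed.

Let delta (b : K) (h : gT) : KG := [ffun g => if g == h then b else 0].

Fact te_form_nondeg (y z : KG) :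
  (forall x, te_form x y = te_form x z) -> y = z.
Proof.
move=> eq_yz; apply/ffunP=> h; apply/eqP; rewrite -subr_eq0; apply/eqP.
apply: fftr_nondeg => b; move: (eq_yz (delta b h)); rewrite /te_form.
have sumE (w : KG) : \sum_g delta b h g * w g = b * w h.
  rewrite (bigD1 h) //= ffunE eqxx big1 ?addr0 // => g /negPf gh.
  by rewrite ffunE gh mul0r.
by rewrite !sumE mulrBr fftrB => ->; rewrite subrr.
Qed.

Fact ffconjK : ~~ odd (\dim {:K}) -> involutive ffconj.
Proof.
move=> even_m b; rewrite /ffconj -exprM -expnD addnn even_halfK //.
by apply/eqP; rewrite -(Fermat's_little_theorem {:K}) memvf.
Qed.

Fact th_form_nondeg (y z : KG) : ~~ odd (\dim {:K}) ->
  (forall x, th_form x y = th_form x z) -> y = z.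
Proof.
move=> even_m eq_yz.
pose conjv (w : KG) : KG := [ffun g => ffconj (w g)].
have th_te x w : th_form x w = te_form x (conjv w).
  by congr fftr; apply: eq_bigr => g _; rewrite ffunE.
have /ffunP eq_c : conjv y = conjv z.
  by apply: te_form_nondeg => x; rewrite -!th_te.
apply/ffunP=> g; apply: (can_inj (ffconjK even_m)).
by have := eq_c g; rewrite !ffunE.
Qed.

Fact te_adjoint_uniq T S S' :
  is_adjoint te_form T S -> is_adjoint te_form T S' -> S =1 S'.
Proof.
move=> [_ adjS] [_ adjS'] y.
by apply: te_form_nondeg => x; rewrite -adjS -adjS'.
Qed.

Fact th_adjoint_uniq T S S' : ~~ odd (\dim {:K}) ->
  is_adjoint th_form T S -> is_adjoint th_form T S' -> S =1 S'.
Proof.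
move=> even_m [_ adjS] [_ adjS'] y.
by apply: (th_form_nondeg even_m) => x; rewrite -adjS -adjS'.
Qed.

End Forms.

(* Main.v *)
(* If C meets its orthogonal trivially then KG is the direct sum of C and its
   orthogonal, and the projector P onto C along the orthogonal is self-adjoint.
   It is FG-linear because the orthogonal is an FG-submodule: the adjoint of the
   action of a group element is the action of its inverse.  Conversely, if P is a
   self-adjoint projector onto C and x in C is orthogonal to C, then
   <x, y> = <P x, y> = <x, P y> = 0 for all y, so x = 0 by nondegeneracy.  The
   Hermitian form is symmetric because the trace is invariant under q-powers. *)
Require Import Defs.
From HB Require Import structures.
Set Warnings "-notation-overridden,-ambiguous-paths,-redundant-canonical-projection".
From mathcomp Require Import all_boot all_order all_algebra all_fingroup all_solvable all_field.
Set Implicit Arguments. Unset Strict Implicit. Unset Printing Implicit Defensive.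
Import GRing.Theory.
Local Open Scope ring_scope.

(** * Linear algebra: splitting off a nondegenerate subspace *)

Section OrthogonalDecomposition.
Variables (F : fieldType) (V : vectType F) (b : V -> V -> F).
Hypothesis b_linl : forall v, scalar (b^~ v).
Hypothesis b_linr : forall v, scalar (b v).
Variable U : {vspace V}.

Let coords (x : V) : 'rV[F]_(\dim U) := \row_i b (vbasis U)`_i x.

Fact coords_is_linear : linear coords.
Proof. by move=> k x y; apply/rowP=> i; rewrite !mxE b_linr. Qed.

HB.instance Definition _ :=
  GRing.isLinear.Build F V 'rV[F]_(\dim U) _ coords coords_is_linear.

Let coords_eq0 x : coords x = 0 -> forall v, v \in U -> b v x = 0.
Proof.
move=> /rowP fx0 v /coord_vbasis ->.
have b0 : b 0 x = 0 by rewrite -[0](subrr 0) -scaleN1r addrC b_linl mulN1r addNr.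
elim/big_rec: _ => // i y _ IHy.
by rewrite b_linl IHy; have := fx0 i; rewrite !mxE => ->; rewrite mulr0 addr0.
Qed.

(* Pairing against a basis of U is a linear map U -> F^(dim U) with trivial
   kernel, hence onto: some c in U pairs with U exactly as x does. *)
Lemma orthogonal_decomposition :
  (forall u, u \in U -> (forall v, v \in U -> b v u = 0) -> u = 0) ->
  forall x, exists2 c, c \in U & forall v, v \in U -> b v (x - c) = 0.
Proof.
move=> nondegU x; pose f := linfun coords.
have kerU : (U :&: lker f = 0)%VS.
  apply/eqP; rewrite -subv0; apply/subvP=> u; rewrite memv_cap memv_ker memv0.
  by rewrite lfunE => /andP[Uu /eqP/coords_eq0 fu]; apply/eqP/nondegU.
have imU : (f @: U)%VS = fullv.
  apply/eqP; rewrite eqEdim subvf limg_dim_eq // dimvf /dim /=.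
  by rewrite mul1n.
have /memv_imgP[c Uc] : f x \in (f @: U)%VS by rewrite imU memvf.
rewrite !lfunE /= => fxc; exists c => //; apply: coords_eq0.
by rewrite -[LHS]/(coords (x - c)) linearB /= fxc subrr.
Qed.

End OrthogonalDecomposition.

(** * Self-adjoint projectors for an abstract symmetric form *)

Section Projection.
Variables (F : finFieldType) (K : fieldExtType F) (gT : finGroupType).
Local Notation FG := (grpalg F gT).
Local Notation KG := (grpmod K gT).

Lemma grpmod_scale_alg (k : F) (x : KG) (g : gT) :
  ((k%:A : FG) *: x) g = k *: x g.
Proof.
rewrite /GRing.scale /= /grpmod_scale ffunE (bigD1 1%g) //= big1 => [|h h1].
  by rewrite !ffunE eqxx mulr1 invg1 mul1g addr0 -scalerAl mul1r.
by rewrite !ffunE (negPf h1) mulr0 scale0r mul0r.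
Qed.

(** The hypotheses collect what the two trace forms share. [B_adj] makes the orthogonal of a
    submodule a submodule. *)
Variable B : KG -> KG -> K.
Hypothesis B_sym : forall x y, B x y = B y x.
Hypothesis B_lin : forall (k : F) x y z,
  B ((k%:A : FG) *: x + y) z = k *: B x z + B y z.
Hypothesis B_in_F : forall x y, B x y \in 1%VS.
Hypothesis B_adj : forall a : FG, exists a' : FG, forall x y,
  B (a *: x) y = B x (a' *: y).
Hypothesis B_nondeg : forall y, (forall x, B x y = 0) -> y = 0.

Let BB x y z : B x (y - z) = B x y - B x z.
Proof.
have := B_lin (-1) z y x; rewrite [_ *: z](_ : _ = - z) => [|].
  by rewrite addrC B_sym => ->; rewrite !(B_sym x) scaleN1r addrC.
by apply/ffunP=> g; rewrite grpmod_scale_alg ffunE scaleN1r.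
Qed.

Let B0 x : B x 0 = 0. Proof. by rewrite -(subrr 0) BB subrr. Qed.

Variables (C : {pred KG}) (subC : submod_closed C).

Let C0 : 0 \in C. Proof. by case: subC. Qed.
Let CZ a x : x \in C -> a *: x \in C.
Proof. by move=> Cx; rewrite -[_ *: _]addr0; case: subC => _; apply. Qed.
Let CD x y : x \in C -> y \in C -> x + y \in C.
Proof. by move=> Cx Cy; rewrite -[x]scale1r; case: subC => _; apply. Qed.
Let CB x y : x \in C -> y \in C -> x - y \in C.
Proof. by move=> Cx Cy; rewrite CD // -scaleN1r CZ. Qed.

Lemma lcd_decomposition : lcd B C ->
  forall x, exists2 c, c \in C & perp B C (x - c).
Proof.
(* [V] is KG as an F-space; it is a finite type over [finvect_type K], so [C] can be enumerated. *)
move=> lcdC x; pose V : vectType F := {ffun gT -> finvect_type K}.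
pose e := enum (C : {pred {ffun gT -> finvect_type K}}).
pose U : {vspace V} := <<e>>%VS.
have scaleE (k : F) (w : V) : k *: w = (k%:A : FG) *: (w : KG).
  by apply/ffunP=> g; rewrite grpmod_scale_alg ffunE.
(* [C] is its own F-span, since F acts through FG. *)
have UC v : (v \in U) = ((v : KG) \in C).
  apply/idP/idP => [|Cv]; last by rewrite memv_span ?mem_enum.
  move/(coord_span (X := in_tuple e)) => ->.
  elim/big_rec: _ => // i y _ Cy; apply: CD => //.
  rewrite scaleE; apply: CZ; have := mem_nth 0 (ltn_ord i).
  by rewrite mem_enum.
(* By [B_in_F] the values of [B] lie on the F-line of 1 in K; [b] reads off the coefficient in F. *)
pose one := [tuple 1 : K]; pose b (v w : V) : F := coord one ord0 (B v w).
have bE (v w : V) : B v w = b v w *: 1.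
  have := B_in_F v w; rewrite -span_seq1 => /(coord_span (X := one)).
  by rewrite big_ord1.
have b_linl v : scalar (b^~ v).
  by move=> k w y; rewrite /b -linearP -B_lin -scaleE.
have b_sym v w : b v w = b w v by rewrite /b B_sym.
have b_linr v : scalar (b v).
  by move=> k w y; rewrite !(b_sym v) b_linl.
have [|c Uc c_perp] := orthogonal_decomposition b_linl b_linr (U := U) _ x.
  move=> u; rewrite UC => Cu u_perp; apply/lcdC; split=> // c Cc.
  by rewrite B_sym bE u_perp ?UC // scale0r.
exists c; first by rewrite -UC.
by move=> v Cv; rewrite B_sym bE [b _ _]c_perp ?UC // scale0r.
Qed.

Section LcdProjector.
Hypothesis lcdC : lcd B C.

(** A boolean restatement over a finite type, from which [xchoose] can extract the component. *)
Let decomp x : exists c : {ffun gT -> finvect_type K},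
  (c \in C) && [forall d in (C : {pred {ffun gT -> finvect_type K}}),
                 B (x - c) d == 0].
Proof.
have [c Cc c_perp] := lcd_decomposition lcdC x; exists c; rewrite [c \in C]Cc.
by apply/forall_inP=> d Cd; apply/eqP/c_perp.
Qed.

Definition lcd_proj (x : KG) : KG := xchoose (decomp x).

Lemma lcd_projP x : lcd_proj x \in C /\ perp B C (x - lcd_proj x).
Proof.
have /andP[Cp /forall_inP p_perp] := xchooseP (decomp x).
by split=> // c Cc; apply/eqP/p_perp.
Qed.

(** Two such components of [x] differ by an element of [C] orthogonal to [C], hence by 0. Linearity
    and idempotence of [lcd_proj] both reduce to this. *)
Lemma lcd_proj_uniq x c : c \in C -> perp B C (x - c) -> lcd_proj x = c.
Proof.
have [Cp p_perp] := lcd_projP x => Cc c_perp; apply/eqP; rewrite -subr_eq0.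
apply/eqP/lcdC; split=> [|d Cd]; first exact: CB.
have -> : lcd_proj x - c = (x - c) - (x - lcd_proj x).
  by rewrite opprB [RHS]addrC addrA subrK.
by rewrite B_sym BB !(B_sym d) p_perp ?c_perp // subrr.
Qed.

Fact lcd_proj_is_linear : linear lcd_proj.
Proof.
move=> a x y; have [[Cx px] [Cy py]] := (lcd_projP x, lcd_projP y).
apply: lcd_proj_uniq => [|d Cd]; first by rewrite CD ?CZ.
(* Moving [a] across the form replaces [d] by [a' *: d], which is still in [C]. *)
have [a' aE] := B_adj a.
(* The scalar 1 = 1%:A is inserted to match B_lin. *)
rewrite opprD addrACA -scalerBr -[_ *: _]scale1r -[1]scale1r B_lin aE.
by rewrite px ?CZ // py // scaler0 addr0.
Qed.

HB.instance Definition _ :=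
  GRing.isLinear.Build FG KG KG _ lcd_proj lcd_proj_is_linear.

End LcdProjector.

Lemma lcd_iff_projector :
  lcd B C <->
  exists P : {linear KG -> KG},
    [/\ forall x, P (P x) = P x,
        forall y, y \in C <-> exists x, P x = y
      & self_adjoint B P].
Proof.
split=> [lcdC | [P [PP imP [_ adjP]]] x].
  have projC c : c \in C -> lcd_proj lcdC c = c.
    by move=> Cc; apply: lcd_proj_uniq => // d _; rewrite subrr B_sym B0.
  exists (lcd_proj lcdC : {linear KG -> KG}); split=> [x|y|] /=.
  - by apply: projC; case: (lcd_projP lcdC x).
  - split=> [Cy|[x <-]]; first by exists y; apply: projC.
    by case: (lcd_projP lcdC x).
  split=> [a x y|x y]; first exact: lcd_proj_is_linear.
  (* Both sides equal the form of the two projections, as each remainder is orthogonal to [C]. *)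
  have [[Cx px] [Cy py]] := (lcd_projP lcdC x, lcd_projP lcdC y).
  have /eqP := py _ Cx; rewrite B_sym BB subr_eq0 => /eqP ->.
  by have /eqP := px _ Cy; rewrite B_sym BB subr_eq0 B_sym => /eqP ->; rewrite B_sym.
split=> [[/imP[z zx] x_perp] | ->].
  have Px : P x = x by rewrite -zx PP.
  apply: B_nondeg => y; rewrite -Px -adjP B_sym x_perp //.
  by apply/imP; exists y.
by split=> // d _; rewrite B_sym B0.
Qed.

End Projection.

(** * Trace forms twisted by an F-linear map of K *)

Section TwistedForm.
Variables (F : finFieldType) (K : fieldExtType F) (gT : finGroupType).
Local Notation FG := (grpalg F gT).
Local Notation KG := (grpmod K gT).

Lemma card_pow_fixed (k : F) n : k ^+ (#|F| ^ n) = k.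
Proof. by elim: n => [|n IHn]; rewrite ?expr1 // expnSr exprM IHn expf_card. Qed.

(** [#|F|] is a power of the characteristic, so this map is an iterate of the Frobenius. *)
Lemma pow_cardD n : {morph (fun a : K => a ^+ (#|F| ^ n)) : a b / a + b}.
Proof.
have [p p_pr pcharF] := finPcharP F.
have pcharK : p \in [pchar K] by rewrite pchar_lalg.
move=> a b; apply: exprDn_pchar.
rewrite (eq_pnat _ (pcharf_eq pcharK)) pnatX; apply/orP; left.
by rewrite (card_pprimeChar pcharF) pnatX pnat_id.
Qed.

Lemma fftrD : {morph @fftr F K : a b / a + b}.
Proof. exact: raddfD (galTrace 1 {:finvect_type K}). Qed.

Lemma fftr_sum I (r : seq I) (P : pred I) (E : I -> K) :
  fftr (\sum_(i <- r | P i) E i) = \sum_(i <- r | P i) fftr (E i).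
Proof. exact: raddf_sum (galTrace 1 {:finvect_type K}) _ _ _ _. Qed.

Lemma fftrZ (k : F) (a : K) : fftr (k *: a) = k *: fftr a.
Proof.
rewrite !fftrE scaler_sumr; apply: eq_bigr => i _.
by rewrite exprZn card_pow_fixed.
Qed.

Lemma pow_card_dim (a : K) : a ^+ (#|F| ^ \dim {:K}) = a.
Proof. by apply/eqP; rewrite -(Fermat's_little_theorem {:K}) memvf. Qed.

(** With q = [#|F|], a q-th power shifts the summands of the trace cyclically: the last one becomes
    a^(q^m) = a. *)
Lemma fftr_pow_card (a : K) n : fftr (a ^+ (#|F| ^ n)) = fftr a.
Proof.
elim: n => [|n <-]; first by rewrite expr1.
rewrite expnSr exprM; move: (a ^+ _) => {}a; rewrite !fftrE.
have := pow_card_dim a; case: (\dim _) => [_|d a_d]; first by rewrite !big_ord0.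
rewrite [LHS]big_ord_recr [RHS]big_ord_recl /= -exprM -expnS a_d addrC.
by congr (_ + _); apply: eq_bigr => i _; rewrite -exprM -expnS.
Qed.

Variable s : K -> K.
Hypothesis sD : {morph s : a b / a + b}.
Hypothesis sZ : forall (k : F) a, s (k *: a) = k *: s a.

(** The identity as [s] gives [te_form], and [ffconj] gives [th_form]. *)
Let B (x y : KG) : K := fftr (\sum_(g : gT) x g * s (y g)).

Lemma twisted_form_linear (k : F) x y z :
  B ((k%:A : FG) *: x + y) z = k *: B x z + B y z.
Proof.
rewrite /B -fftrZ -fftrD; congr fftr; rewrite scaler_sumr -big_split.
apply: eq_bigr => g _ /=.
by rewrite ffunE grpmod_scale_alg mulrDl scalerAl.
Qed.

Lemma twisted_form_adj (a : FG) :
  exists a' : FG, forall x y, B (a *: x) y = B x (a' *: y).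
Proof.
(* The witness is [a] with every group element inverted; its coefficients in F pass through [s]. *)
exists [ffun h => a h^-1%g] => x y; congr fftr.
have scaleE (c : FG) (w : KG) g : (c *: w) g = \sum_h c h *: w (h^-1 * g)%g.
  rewrite ffunE; apply: eq_bigr => h _.
  by rewrite ffunE -scalerAl mul1r.
have s0 : s 0 = 0 by have := sZ 0 0; rewrite !scale0r.
under eq_bigr => g _ do rewrite scaleE mulr_suml.
under [RHS]eq_bigr => g _ do rewrite scaleE (big_morph s sD s0) mulr_sumr.
(* Inverting [h] on the right and replacing [g] by [h * g] on the left matches the double sums. *)
rewrite exchange_big [RHS]exchange_big [RHS](reindex_inj invg_inj) /=.
apply: eq_bigr => h _; rewrite (reindex_inj (mulgI h)).
apply: eq_bigr => g _ /=.
by rewrite ffunE invgK mulKg sZ -scalerAl scalerAr.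
Qed.

End TwistedForm.

Theorem theorem3p20 (F : finFieldType) (K : fieldExtType F)
    (gT : finGroupType) (m : nat) (dimK : \dim {:K} = m)
    (C : {pred grpmod K gT}) (subC : submod_closed C) :
  (lcd (@te_form _ K gT) C <->
     exists P : {linear grpmod K gT -> grpmod K gT},
       [/\ forall x, P (P x) = P x,
           forall y, y \in C <-> exists x, P x = y
         & self_adjoint (@te_form _ K gT) P])
  /\
  (~~ odd m ->
   (lcd (@th_form _ K gT) C <->
     exists P : {linear grpmod K gT -> grpmod K gT},
       [/\ forall x, P (P x) = P x,
           forall y, y \in C <-> exists x, P x = y
         & self_adjoint (@th_form _ K gT) P])).
Proof.
split=> [|even_m].
- apply: lcd_iff_projector subC => [x y|k x y z|x y|a|y y0].
  + by congr fftr; apply: eq_bigr => g _; rewrite mulrC.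
  + exact: (twisted_form_linear id).
  + exact: fftr_in_F.
  + exact: (@twisted_form_adj _ _ _ id).
  apply: te_form_nondeg => x; rewrite y0 /te_form big1 => [|g _].
    by rewrite -[0 in RHS](subrr 0) fftrB subrr.
  by rewrite ffunE mulr0.
have conj0 : @ffconj F K 0 = 0.
  by rewrite /ffconj expr0n expn_eq0; case: #|F| (finNzRing_gt1 F).
rewrite -dimK in even_m; apply: lcd_iff_projector subC => [x y|k x y z|x y|a|y y0].
(* Conjugation inside the trace leaves its value unchanged and, being an involution for even m,
   moves the bar from one factor to the other. *)
- rewrite /th_form -[LHS](fftr_pow_card _ (\dim {:K})./2) -/(ffconj _).
  have conjD : {morph @ffconj F K : a b / a + b} by apply: pow_cardD.
  congr fftr; rewrite (big_morph _ conjD conj0); apply: eq_bigr => g _.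
  by rewrite {1}/ffconj exprMn -!/(ffconj _) ffconjK // mulrC.
- exact: (twisted_form_linear (@ffconj F K)).
- exact: fftr_in_F.
- apply: (@twisted_form_adj _ _ _ (@ffconj F K)) => [|k b]; first exact: pow_cardD.
  by rewrite /ffconj exprZn card_pow_fixed.
apply: th_form_nondeg => // x; rewrite y0 /th_form big1 => [|g _].
  by rewrite -[0 in RHS](subrr 0) fftrB subrr.
by rewrite ffunE conj0 mulr0.
Qed.
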